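(* For every integer $k\geqslant 1$ there exists a natural number $n\geqslant1$ such that there are infinitely many positive integers $m$ with $t(m+j)=t(n+j)$ for all $0\leqslant j\leqslant k$ (i.e. $|O(n,n+1,\ldots,n+k)|=+\infty$).
   Context: Every integer $n\ge 1$ is assigned a finite rooted planar tree $t(n)$: $t(1)$ is the single-vertex tree; if $n=p_1^{a_1}\cdots p_s^{a_s}$ with primes $p_1<\dots<p_s$ and $a_i\ge1$, then $t(n)$ consists of a root with $s$ edges to children, ordered left to right, the $i$-th edge leading to a copy of $t(a_i)$ rooted at that child. $|O(n,\ldots,n+k)|$ denotes the number of $m\ge1$ with $t(m+j)=t(n+j)$ for all $0\le j\le k$. *)

(* Defs.v *)
From mathcomp Require Import all_boot.
From mathcomp Require Import classical_sets cardinality.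

Set Implicit Arguments.
Unset Strict Implicit.
Unset Printing Implicit Defensive.

Local Open Scope classical_set_scope.

(* Finite rooted planar trees: the list of the subtrees at the children of the
   root, from left to right. *)
Inductive ptree : Type := Node of seq ptree.

(* [prime_decomp n] lists the pairs (p_i, a_i) with p_1 < ... < p_s and
   a_i >= 1. The recursion is bounded by [d]; since a_i < n, the bound d = n
   never stops it early (lemma [tE]). *)
Fixpoint t_rec (d n : nat) : ptree :=
  if d is d'.+1 then Node [seq t_rec d' pa.2 | pa <- prime_decomp n]
  else Node [::].

(* [t 0] is a junk value. *)
Definition t (n : nat) : ptree := t_rec n n.

Lemma prime_decomp_exp_lt (n : nat) (pa : nat * nat) :
  pa \in prime_decomp n -> pa.2 < n.
Proof.
case: n => [//|n]; case: pa => p a /mem_prime_decomp[pr_p _ dvd_n] /=.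
exact: leq_trans (ltn_expl a (prime_gt1 pr_p)) (dvdn_leq (ltn0Sn n) dvd_n).
Qed.

Lemma t_rec_stable (d1 d2 n : nat) :
  n <= d1 -> n <= d2 -> t_rec d1 n = t_rec d2 n.
Proof.
elim: d1 d2 n => [|d1 IH] [|d2] n //=; rewrite ?leqn0.
- by move=> /eqP->.
- by move=> _ /eqP->.
move=> le1 le2; congr Node; apply/eq_in_map => pa /prime_decomp_exp_lt lt_n.
by apply: IH; rewrite -ltnS; apply: leq_trans lt_n _.
Qed.

Lemma tE (n : nat) : t n = Node [seq t pa.2 | pa <- prime_decomp n].
Proof.
rewrite /t; case: n => [//|n] /=; congr Node.
apply/eq_in_map => pa /prime_decomp_exp_lt lt_n.
by apply: t_rec_stable.
Qed.

(* O(n, n+1, ..., n+k) *)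
Definition O_set (n k : nat) : set nat :=
  [set m | 1 <= m /\ forall j : nat, 0 <= j <= k -> t (m + j) = t (n + j)].

(* Main.v *)
Require Import Defs.
From mathcomp Require Import all_boot.
From mathcomp Require Import boolp classical_sets cardinality.
From mathcomp Require Import all_order all_algebra.
From mathcomp Require Import zify ring lra.

(** By pigeonhole it suffices to find a constant [c] and infinitely many [m] such
    that each of [m], ..., [m + k] has at most [c] prime divisors, with exponents
    at most [c]: only finitely many tuples of trees are then possible.

    Put [m = 1 + W (h + 1)] with [W = (D!)^2].  For a prime [p <= D] the exponent
    of [p] in [m + j = (j + 1) + W (h + 1)] is that of [j + 1], and the primes
    [p > D] do not divide [W].  If [h] is bounded by a fixed power of [z] and no
    prime in [(D, z]] divides any [m + j], then the prime divisors of [m + j] beyond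
    [D] exceed [z], so there are boundedly many of them.

    Such an [h] comes from the Brun-Hooley sieve.  The primes in [(D, z]] are cut
    into levels [(2^2^i, 2^2^(i+1)]].  On level [i] let [Pi_i] be the indicator
    that no prime hits, [Y_i >= Pi_i] the inclusion-exclusion sum truncated at the
    even order [b_i], and [Z_i] the elementary symmetric function of order
    [b_i + 1], so that [Y_i - Pi_i <= Z_i].  Then
    [prod Pi_i >= prod Y_i - sum_i Z_i prod_(j != i) Y_j].  The right-hand side is a
    polynomial in the indicators, and averaging it over [h] replaces, up to a power
    of [z], the indicator of [p] by [(k + 1) / p].  Chebyshev's bound makes the sum
    of these densities over a level bounded independently of the level, so with
    [b_i] growing linearly in the distance to the top level the main term wins. *)

Set Implicit Arguments.
Unset Strict Implicit.
Unset Printing Implicit Defensive.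

Import Order.TTheory GRing.Theory Num.Theory.
Local Open Scope ring_scope.

(** * Truncated inclusion-exclusion and elementary symmetric sums *)

(* The sum of [(-1)^|S| * prod_(p in S) x p] over the [S] in [s] of size at most [b]. *)
Fixpoint altsym (R : pzRingType) (x : nat -> R) (s : seq nat) (b : nat) : R :=
  match s, b with
  | p :: s', b'.+1 => altsym x s' b'.+1 - x p * altsym x s' b'
  | _, _ => 1
  end.

Fixpoint elsym (R : pzRingType) (x : nat -> R) (s : seq nat) (b : nat) : R :=
  match b, s with
  | 0%N, _ => 1
  | _.+1, [::] => 0
  | b'.+1, p :: s' => elsym x s' b'.+1 + x p * elsym x s' b'
  end.

Lemma altsym0 (R : pzRingType) (x : nat -> R) s : altsym x s 0%N = 1.
Proof. by case: s. Qed.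

Lemma elsym0 (R : pzRingType) (x : nat -> R) s : elsym x s 0%N = 1.
Proof. by case: s. Qed.

Definition unit_on (R : numDomainType) (x : nat -> R) (s : seq nat) :=
  all (fun p => 0 <= x p <= 1) s.

Lemma elsym_ge0 (R : realFieldType) (x : nat -> R) s b :
  unit_on x s -> 0 <= elsym x s b.
Proof.
elim: s b => [|p s IH] [|b] //= /andP[/andP[x0 x1] xs].
by rewrite addr_ge0 ?mulr_ge0 ?IH.
Qed.

Lemma prod_compl_bounds (R : realFieldType) (x : nat -> R) s :
  unit_on x s -> 0 <= \prod_(p <- s) (1 - x p) <= 1.
Proof.
elim: s => [|p s IH] /=; first by rewrite big_nil ler01 lexx.
case/andP=> /andP[x0 x1] /IH; rewrite big_cons => /andP[? ?]; nra.
Qed.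

Lemma prod_compl_ge (R : realFieldType) (x : nat -> R) s :
  unit_on x s -> 1 - \sum_(p <- s) x p <= \prod_(p <- s) (1 - x p).
Proof.
elim: s => [|p s IH] /=; first by rewrite !big_nil subr0.
case/andP=> /andP[x0 x1] xs; rewrite !big_cons.
have := IH xs; have /andP[? ?] := prod_compl_bounds xs; nra.
Qed.

Lemma elsym1 (R : pzRingType) (x : nat -> R) s : elsym x s 1%N = \sum_(p <- s) x p.
Proof.
elim: s => [|p s IH] /=; first by rewrite big_nil.
by rewrite big_cons IH elsym0 mulr1 addrC.
Qed.

(* The signed remainder satisfies the recursion of [elsym] shifted by one. *)
Lemma altsym_remainder (R : realFieldType) (x : nat -> R) s b :
  unit_on x s ->
  0 <= (-1) ^+ b * (altsym x s b - \prod_(p <- s) (1 - x p)) <= elsym x s b.+1.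
Proof.
elim: s b => [|p s IH] b; first by rewrite big_nil subrr mulr0 /= lexx.
move=> xs; case/andP: (xs) => /andP[x0 x1] xs'.
case: b => [|b].
  rewrite expr0 mul1r altsym0 elsym1.
  have := prod_compl_ge xs; have := prod_compl_bounds xs.
  by move=> /andP[? ?] ?; apply/andP; split; lra.
have /andP[l1 u1] := IH b xs'; have /andP[l2 u2] := IH b.+1 xs'.
rewrite big_cons; set P := \prod_(q <- s) _ in l1 u1 l2 u2 *.
have -> : (-1) ^+ b.+1 * (altsym x (p :: s) b.+1 - (1 - x p) * P) =
  (-1) ^+ b.+1 * (altsym x s b.+1 - P) + x p * ((-1) ^+ b * (altsym x s b - P)).
  by rewrite /= exprS; ring.
apply/andP; split; first by apply: addr_ge0 => //; apply: mulr_ge0.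
by apply: lerD => //; apply: ler_wpM2l.
Qed.

Lemma altsym_even_bounds (R : realFieldType) (x : nat -> R) s b :
  unit_on x s -> ~~ odd b ->
  \prod_(p <- s) (1 - x p) <= altsym x s b
    <= \prod_(p <- s) (1 - x p) + elsym x s b.+1.
Proof.
move=> xs eb; have := altsym_remainder b xs.
by rewrite -signr_odd (negbTE eb) expr0 mul1r subr_ge0 lerBlDl.
Qed.

Lemma exprD_ge (R : realFieldType) (a x : R) n : 0 <= a -> 0 <= x ->
  a ^+ n.+1 + n.+1%:R * x * a ^+ n <= (a + x) ^+ n.+1.
Proof.
move=> a0 x0; elim: n => [|n IH]; first by rewrite !expr1 expr0 mulr1 mul1r.
rewrite (exprS (a + x)).
apply: le_trans (ler_wpM2l _ IH); last by rewrite addr_ge0.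
have h : 0 <= a ^+ n by rewrite exprn_ge0.
have -> : n.+2%:R = n.+1%:R + 1 :> R by rewrite -[in LHS]natr1.
rewrite !exprS -subr_ge0; set c := n.+1%:R.
rewrite (_ : _ - _ = c * x ^+ 2 * a ^+ n); last by ring.
by rewrite !mulr_ge0 ?exprn_ge0 ?ler0n.
Qed.

(** Expanding the power of the sum yields each squarefree monomial of degree [b] exactly [b!] times,
    and all other monomials are nonnegative. *)
Lemma elsym_fact_le (R : realFieldType) (x : nat -> R) s b : unit_on x s ->
  b`!%:R * elsym x s b <= (\sum_(p <- s) x p) ^+ b.
Proof.
elim: s b => [|p s IH] [|b]; rewrite ?fact0 ?mul1r //=.
  by rewrite mulr0 big_nil expr0n.
case/andP=> /andP[x0 x1] xs; rewrite big_cons [x p + _]addrC.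
have S0 : 0 <= \sum_(q <- s) x q.
  rewrite big_seq; apply: sumr_ge0 => q qs.
  by case/andP: (allP xs q qs).
apply: le_trans (exprD_ge b S0 x0); rewrite mulrDr; apply: lerD; first exact: IH.
rewrite factS natrM -!mulrA ler_wpM2l ?ler0n //.
by rewrite mulrCA ler_wpM2l // IH.
Qed.

(** * The Brun-Hooley inequality *)

Fixpoint upper_part (R : pzRingType) (x : nat -> R) (s : nat -> seq nat)
    (b : nat -> nat) (I : seq nat) : R :=
  if I is i :: I' then altsym x (s i) (b i) * upper_part x s b I' else 1.

(* Unfolds to [prod_i Y_i - sum_i Z_i prod_(j != i) Y_j]. *)
Fixpoint lower_part (R : pzRingType) (x : nat -> R) (s : nat -> seq nat)
    (b : nat -> nat) (I : seq nat) : R :=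
  if I is i :: I' then
    altsym x (s i) (b i) * lower_part x s b I'
      - elsym x (s i) (b i).+1 * upper_part x s b I'
  else 1.

Lemma upper_part_ge (R : realFieldType) (x : nat -> R) s b I :
  all (fun i => unit_on x (s i) && ~~ odd (b i)) I ->
  0 <= \prod_(i <- I) \prod_(p <- s i) (1 - x p) <= upper_part x s b I.
Proof.
elim: I => [|i I IH] /=; first by rewrite big_nil ler01 lexx.
case/andP=> /andP[xs eb] /IH/andP[h1 h2].
have /andP[h3 _] := prod_compl_bounds xs.
have /andP[h4 _] := altsym_even_bounds xs eb.
by rewrite big_cons mulr_ge0 //= ler_pM.
Qed.

(** With [P] the head product and [V] the tail product, induction bounds the left side by
    [Y * V - Z * V], and [Y - Z <= P]. *)
Lemma lower_part_le (R : realFieldType) (x : nat -> R) s b I :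
  all (fun i => unit_on x (s i) && ~~ odd (b i)) I ->
  lower_part x s b I <= \prod_(i <- I) \prod_(p <- s i) (1 - x p).
Proof.
elim: I => [|i I IH] /=; first by rewrite big_nil lexx.
case/andP=> /andP[xs eb] xI; have h0 := IH xI.
have /andP[h1 h2] := upper_part_ge xI.
have /andP[h3 _] := prod_compl_bounds xs.
have /andP[h4 h5] := altsym_even_bounds xs eb.
have h6 := elsym_ge0 (b i).+1 xs.
rewrite big_cons.
set V := \prod_(j <- I) _ in h0 h1 h2 *; set F := lower_part _ _ _ _ in h0 *.
set G := upper_part _ _ _ _ in h2 *; set Y := altsym _ _ _ in h4 h5 *.
set Z := elsym _ _ _ in h5 h6 *; set P := \prod_(p <- _) _ in h3 h4 h5 *.
have Y0 : 0 <= Y by lra.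
have := ler_wpM2l Y0 h0; have := ler_wpM2l h6 h2; have := ler_wpM2r h1 h5; lra.
Qed.

(** Since [Z <= tau i * P <= tau i * Y], the term subtracted at level [i] costs at most the fraction
    [tau i] of the whole upper product. *)
Lemma lower_part_ge (R : realFieldType) (x : nat -> R) s b (tau : nat -> R) I :
  all (fun i => [&& unit_on x (s i), ~~ odd (b i) &
        elsym x (s i) (b i).+1 <= tau i * \prod_(p <- s i) (1 - x p)]) I ->
  (forall i, 0 <= tau i) ->
  (1 - \sum_(i <- I) tau i) * upper_part x s b I <= lower_part x s b I.
Proof.
move=> + tau0; elim: I => [|i I IH] /=; first by rewrite big_nil subr0 mulr1.
case/andP=> /and3P[xs eb ht] xI; have h0 := IH xI.
have /upper_part_ge/andP[h1 h2] :
    all (fun i => unit_on x (s i) && ~~ odd (b i)) I.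
  by apply: sub_all xI => j /and3P[-> ->].
have /andP[h3 _] := prod_compl_bounds xs.
have /andP[h4 h5] := altsym_even_bounds xs eb.
rewrite big_cons.
set V := \prod_(j <- I) _ in h1 h2; set F := lower_part _ _ _ _ in h0 *.
set G := upper_part _ _ _ _ in h0 h2 *; set Y := altsym _ _ _ in h4 h5 *.
set Z := elsym _ _ _ in h5 ht *; set P := \prod_(p <- _) _ in ht h3 h4 h5 *.
set sg := \sum_(j <- I) _ in h0 *.
have Y0 : 0 <= Y by lra.
have G0 : 0 <= G by lra.
have ht' : Z <= tau i * Y by apply: le_trans ht _; rewrite ler_wpM2l.
have := ler_wpM2l Y0 h0; have := ler_wpM2r G0 ht'; lra.
Qed.

(** * Equidistribution in progressions *)

(** A count rather than a test, so that it sums to exactly [k] over a full residue system; for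
    [k <= p] it is still 0 or 1. *)
Definition hits (k p m : nat) : nat := (\sum_(j < k) (p %| m + j))%N.

Lemma hits_eq0 (k p m j : nat) : hits k p m = 0%N -> (j < k)%N -> ~~ (p %| m + j)%N.
Proof.
move=> /eqP; rewrite /hits sum_nat_eq0 => /forallP h jk.
by have := h (Ordinal jk); rewrite /= eqb0.
Qed.

Lemma hits_le1 (k p m : nat) : (k <= p)%N -> (hits k p m <= 1)%N.
Proof.
move=> kp; rewrite /hits.
case: (pickP (fun j : 'I_k => (p %| m + j)%N)) => [i pi|h0]; last first.
  by rewrite big1 // => i _; rewrite h0.
rewrite (bigD1 i) //= big1 ?addn0 ?leq_b1 // => j ji.
apply/eqP; rewrite eqb0; apply/negP => pj; case/eqP: ji; apply: val_inj => /=.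
have := ltn_ord i; have := ltn_ord j; move: (nat_of_ord i) (nat_of_ord j) pi pj.
move=> a b pi pj bk ak.
case: (ltngtP b a) => // ab.
- have : (p %| a - b)%N by rewrite -(dvdn_addr _ pj) -addnA subnKC // ltnW.
  by move/dvdn_leq; lia.
- have : (p %| b - a)%N by rewrite -(dvdn_addr _ pi) -addnA subnKC // ltnW.
  by move/dvdn_leq; lia.
Qed.

Lemma hits_modl (k p m c h : nat) : hits k p (m + p * c * h) = hits k p m.
Proof.
apply: eq_bigr => j _; congr nat_of_bool.
by rewrite addnAC dvdn_addl // -mulnA dvdn_mulr.
Qed.

(** As [q] is invertible mod [p], the values [a + q * c] meet each residue class once. *)
Lemma sum_dvdn_progression (p q a : nat) : (0 < p)%N -> coprime q p ->
  (\sum_(c < p) (p %| a + q * c) = 1)%N.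
Proof.
move=> p0 cqp.
have [c hc] : exists c : 'I_p, (p %| a + q * c)%N.
  have /andP[_ /eqP hu] : (0 < p)%N && ((egcdn q p).1 * q == 1 %[mod p])%N.
    rewrite p0 /=; case: (ltnP 0 q) => q0; last first.
      by move: q0 cqp; rewrite leqn0 => /eqP->; rewrite /coprime gcd0n => /eqP->; rewrite !modn1.
    by case: egcdnP => //= u v -> _; rewrite (eqP cqp) modnMDl.
  set u := (egcdn q p).1 in hu.
  (* [u] inverts [q] mod [p], and [p * a - a] represents [-a] within the naturals. *)
  exists (Ordinal (ltn_pmod (u * (p * a - a)) p0)) => /=.
  rewrite /dvdn -modnDmr modnMmr mulnCA mulnA -modnMml hu modnMml mul1n modnDmr.
  by rewrite subnKC ?modnMr // leq_pmull.
rewrite (bigD1 c) //= hc big1 // => d dc; apply/eqP; rewrite eqb0.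
apply: contra dc => hd; apply/eqP/val_inj => /=.
wlog ltcd : c d hc hd / (c <= d)%N.
  by move=> H; case: (leqP c d) => [|/ltnW] le; [|symmetry]; apply: H.
apply/eqP; rewrite eqn_leq ltcd andbT.
have : (p %| q * (d - c))%N.
  by rewrite -(dvdn_addr _ hc) -addnA -mulnDr subnKC.
rewrite Gauss_dvdr; last by rewrite coprime_sym.
rewrite leqNgt; move=> hp; apply/negP => lt; move: hp; apply/negP.
by rewrite gtnNdvd ?subn_gt0 //; have := ltn_ord d; lia.
Qed.

Lemma sum_hits_progression (k p q a : nat) : (0 < p)%N -> coprime q p ->
  (\sum_(c < p) hits k p (a + q * c) = k)%N.
Proof.
move=> p0 cqp; rewrite /hits exchange_big /=.
under eq_bigr => j _.
  under eq_bigr => c _ do rewrite addnAC.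
  rewrite sum_dvdn_progression //; over.
by rewrite sum_nat_const card_ord muln1.
Qed.

Lemma sum_block (R : pzRingType) (g : nat -> R) (p Y : nat) :
  \sum_(h < p * Y) g h = \sum_(c < p) \sum_(h < Y) g (c + p * h)%N.
Proof.
elim: Y => [|Y IH]; first by rewrite muln0 big_ord0 big1 // => c _; rewrite big_ord0.
rewrite mulnS addnC big_split_ord /= IH.
under [RHS]eq_bigr => c _ do rewrite big_ord_recr /=.
rewrite [RHS]big_split /=; congr (_ + _); apply: eq_bigr => c _.
by rewrite addnC.
Qed.

(* The error bound [N] must hold along every progression whose step is coprime to
   [P], so that multiplication by the indicator of a new prime preserves it. *)
Definition equidist (R : numDomainType) (P : seq nat) (f : nat -> R) (mu N : R) :=
  [/\ forall m, `|f m| <= N, `|mu| <= N &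
    forall q a X, all (coprime q) P ->
      `|\sum_(h < X) f (a + q * h)%N - X%:R * mu| <= N].

Lemma equidist_widen (R : numDomainType) P P' (f : nat -> R) mu N N' :
  N <= N' -> {subset P <= P'} -> equidist P f mu N -> equidist P' f mu N'.
Proof.
move=> leN sP [f1 f2 f3]; split=> [m||q a X cq]; [exact: le_trans (f1 m) leN|exact: le_trans leN|].
apply: le_trans (f3 _ _ _ _) leN.
by apply/allP => p /sP; apply: (allP cq).
Qed.

Lemma equidist_ext (R : numDomainType) P (f f' : nat -> R) mu mu' N :
  f =1 f' -> mu = mu' -> equidist P f mu N -> equidist P f' mu' N.
Proof.
move=> e <- [f1 f2 f3]; split=> // [m|q a X cq]; first by rewrite -e.
by under eq_bigr => h _ do rewrite -e; apply: f3.
Qed.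

Lemma equidist1 (R : numDomainType) P : equidist P (fun _ => 1 : R) 1 1.
Proof.
split=> [m||q a X _]; rewrite ?normr1 //.
by rewrite sumr_const card_ord mulr1 subrr normr0 ler01.
Qed.

Lemma equidistN (R : numDomainType) P (f : nat -> R) mu N :
  equidist P f mu N -> equidist P (fun m => - f m) (- mu) N.
Proof.
move=> [f1 f2 f3]; split=> [m||q a X cq]; rewrite ?normrN //.
by rewrite sumrN mulrN -opprD normrN; apply: f3.
Qed.

Lemma equidistD (R : numDomainType) P (f g : nat -> R) mu nu N M :
  equidist P f mu N -> equidist P g nu M ->
  equidist P (fun m => f m + g m) (mu + nu) (N + M).
Proof.
move=> [f1 f2 f3] [g1 g2 g3]; split=> [m||q a X cq].
- by apply: le_trans (ler_normD _ _) _; rewrite lerD.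
- by apply: le_trans (ler_normD _ _) _; rewrite lerD.
rewrite big_split mulrDr opprD addrACA.
by apply: le_trans (ler_normD _ _) _; rewrite lerD ?f3 ?g3.
Qed.

(** Write [X = p * Y + r]. In the full blocks each class mod [p] has constant weight and leaves a
    sum of [f] with step [q * p], again coprime to [P]; the weights add up to [k]. Blocks, tail and
    the mean of the tail each cost at most [k * N], and [3 * k <= p] fits the total into [p * N]. *)
Lemma equidist_hits (R : realFieldType) (k p : nat) P (f : nat -> R) mu N :
  prime p -> (3 * k <= p)%N -> all (coprime p) P -> equidist P f mu N ->
  equidist (p :: P) (fun m => (hits k p m)%:R * f m) (k%:R / p%:R * mu) (p%:R * N).
Proof.
move=> pr kp cp [f1 f2 f3].
have p0 : (0 < p)%N := prime_gt0 pr.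
have p0R : 0 < p%:R :> R by rewrite ltr0n.
have N0 : 0 <= N by apply: le_trans f2.
have kpR : 3 * k%:R <= p%:R :> R by rewrite -natrM ler_nat.
have leNp : N <= p%:R * N by rewrite ler_peMl // ler1n.
have u01 : 0 <= (k%:R / p%:R : R) <= 1.
  rewrite divr_ge0 ?ler0n //= ler_pdivrMr // mul1r ler_nat; lia.
have hN m : `|(hits k p m)%:R * f m| <= (hits k p m)%:R * N.
  by rewrite normrM normr_nat ler_wpM2l // ler0n.
split=> [m||q a X /= /andP[cq cqP]].
- apply: le_trans (hN m) _; rewrite ler_wpM2r // ler_nat.
  by apply: leq_trans (hits_le1 _ _) _ => //; lia.
- apply: le_trans leNp; rewrite normrM ger0_norm; last by case/andP: u01.
  case/andP: u01 => u0 u1; apply: le_trans f2.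
  by rewrite ler_piMl.
set r := (X %% p)%N; set Y := (X %/ p)%N.
have eX : X = (p * Y + r)%N by rewrite mulnC -divn_eq.
have ltr : (r < p)%N by rewrite ltn_pmod.
rewrite [in \sum_(h < X) _]eX big_split_ord /=.
rewrite (sum_block (fun h => (hits k p (a + q * h))%:R * f (a + q * h)%N)).
pose w c : R := (hits k p (a + q * c))%:R.
have w0 c : 0 <= w c by rewrite ler0n.
have sw : \sum_(c < p) w c = k%:R.
  by rewrite -natr_sum sum_hits_progression.
have e1 : `|\sum_(c < p) \sum_(h < Y) (hits k p (a + q * (c + p * h)))%:R *
     f (a + q * (c + p * h))%N - Y%:R * k%:R * mu| <= k%:R * N.
  have -> : Y%:R * k%:R * mu = \sum_(c < p) w c * (Y%:R * mu).
    by rewrite -mulr_suml sw; ring.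
  rewrite -sumrB; apply: le_trans (ler_norm_sum _ _ _) _.
  rewrite -sw mulr_suml; apply: ler_sum => c _.
  have -> : \sum_(h < Y) (hits k p (a + q * (c + p * h)))%:R *
     f (a + q * (c + p * h))%N = w c * \sum_(h < Y) f (a + q * c + q * p * h)%N.
    rewrite mulr_sumr; apply: eq_bigr => h _.
    rewrite mulnDr mulnA addnA; congr (_%:R * _).
    by rewrite (mulnC q p) hits_modl.
  rewrite -mulrBr normrM ger0_norm // ler_wpM2l //; apply: f3.
  apply/allP => x xP; rewrite coprimeMl.
  by rewrite (allP cqP) ?(allP cp).
have e2 : `|\sum_(i < r) (hits k p (a + q * (p * Y + i)))%:R *
     f (a + q * (p * Y + i))%N| <= k%:R * N.
  apply: le_trans (ler_norm_sum _ _ _) _.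
  apply: (@le_trans _ _ (\sum_(i < r) (hits k p (a + q * (p * Y + i)))%:R * N)).
    by apply: ler_sum => i _; apply: hN.
  rewrite -mulr_suml ler_wpM2r // -natr_sum ler_nat.
  rewrite -[X in (_ <= X)%N](@sum_hits_progression k p q (a + q * (p * Y)) p0 cq).
  rewrite -(subnKC (ltnW ltr)) [X in (_ <= X)%N]big_split_ord /=.
  apply: leq_trans (leq_addr _ _); apply: eq_leq; apply: eq_bigr => i _.
  by rewrite mulnDr addnA.
have e3 : `|r%:R * (k%:R / p%:R * mu)| <= k%:R * N.
  rewrite (_ : _ * _ = (r%:R / p%:R) * (k%:R * mu)); last by ring.
  rewrite normrM ger0_norm ?divr_ge0 ?ler0n //.
  apply: (@le_trans _ _ (1 * (k%:R * N))); last by rewrite mul1r.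
  apply: ler_pM; rewrite ?divr_ge0 ?ler0n ?normr_ge0 //.
    by rewrite ler_pdivrMr // mul1r ler_nat ltnW.
  by rewrite normrM normr_nat ler_wpM2l ?ler0n.
have eXR : X%:R * (k%:R / p%:R * mu) = Y%:R * k%:R * mu + r%:R * (k%:R / p%:R * mu).
  rewrite eX natrD natrM; field; exact: lt0r_neq0.
rewrite eXR.
apply: (@le_trans _ _ (3 * k%:R * N)); last by rewrite ler_wpM2r.
move: e1 e2 e3.
set A := \sum_(c < p) _; set B := \sum_(i < r) _; set C := r%:R * _.
rewrite !ler_norml => /andP[? ?] /andP[? ?] /andP[? ?].
by apply/andP; split; lra.
Qed.

(** * Equidistribution of the sieve polynomials *)

Definition hit_vec (R : pzRingType) (k m : nat) : nat -> R :=
  fun p => (hits k p m)%:R.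

Definition density (R : unitRingType) (k : nat) : nat -> R :=
  fun p => k%:R / p%:R.

Definition sieving (k : nat) : pred nat := fun p => prime p && (3 * k <= p)%N.

Lemma coprime_primes (p : nat) (P : seq nat) :
  prime p -> all prime P -> p \notin P -> all (coprime p) P.
Proof.
move=> pr prP pP; apply/allP => q qP; rewrite prime_coprime //.
by rewrite dvdn_prime2 ?(allP prP q) //; apply: contra pP => /eqP->.
Qed.

Lemma hit_vec_unit (R : realFieldType) (k m : nat) s :
  all (sieving k) s -> unit_on (hit_vec R k m) s.
Proof.
move=> h; apply/allP => p /(allP h)/andP[pr kp].
rewrite /hit_vec ler0n lern1 hits_le1 //; lia.
Qed.

Lemma density_unit (R : realFieldType) (k : nat) s :
  all (sieving k) s -> unit_on (density R k) s.
Proof.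
move=> h; apply/allP => p /(allP h)/andP[pr kp].
have p0 : 0 < p%:R :> R by rewrite ltr0n prime_gt0.
rewrite /density divr_ge0 ?ler0n //= ler_pdivrMr // mul1r ler_nat; lia.
Qed.

(** Each indicator of a prime [p] multiplies the error by [p], so the error follows the powers of
    [1 + sumn s], and truncation caps the exponent at [b]. The factor [g] allows the levels to be
    multiplied one after another. *)
Lemma equidist_altsym (R : realFieldType) (k : nat) (s P : seq nat)
    (g : nat -> R) mu N b :
  uniq (s ++ P) -> all (sieving k) (s ++ P) -> equidist P g mu N ->
  equidist (s ++ P) (fun m => altsym (hit_vec R k m) s b * g m)
    (altsym (density R k) s b * mu) (((1 + sumn s) ^ b)%:R * N).
Proof.
move=> + + eg; have N0 : 0 <= N by case: eg => _ f2 _; apply: le_trans f2.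
elim: s b => [|p s IH] b us sv.
  rewrite /= exp1n [X in equidist _ _ _ X]mul1r.
  by apply: (equidist_ext _ _ eg) => [m|]; rewrite mul1r.
case: b => [|b].
  rewrite expn0 [X in equidist _ _ _ X]mul1r.
  have : equidist (p :: s ++ P) g mu N.
    by apply: equidist_widen eg => // q qP; rewrite inE mem_cat qP !orbT.
  by apply: equidist_ext => [m|] /=; rewrite mul1r.
case/andP: us => pn us; case/andP: sv => /andP[pr kp] sv.
have prP : all prime (s ++ P) by apply: sub_all sv => q /andP[].
have e1 := IH b us sv; have e2 := IH b.+1 us sv.
have e3 := equidist_hits pr kp (coprime_primes pr prP pn) e1.
have e2' : equidist (p :: s ++ P) (fun m => altsym (hit_vec R k m) s b.+1 * g m)
    (altsym (density R k) s b.+1 * mu) (((1 + sumn s) ^ b.+1)%:R * N).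
  by apply: equidist_widen (lexx _) _ e2 => q; rewrite inE => ->; rewrite orbT.
have := equidistD e2' (equidistN e3).
move/equidist_widen => h.
apply: equidist_ext (h _ _ _ _) => [m|||//].
- by rewrite /= /hit_vec; ring.
- by rewrite /= /density; ring.
rewrite mulrA -mulrDl ler_wpM2r // -natrM -natrD ler_nat /=.
rewrite expnS -mulnDl expnS; apply: leq_mul; first by lia.
by case: b {IH e1 e2 e3 e2' h} => // b; rewrite leq_exp2r; lia.
Qed.

Lemma equidist_elsym (R : realFieldType) (k : nat) (s P : seq nat)
    (g : nat -> R) mu N b :
  uniq (s ++ P) -> all (sieving k) (s ++ P) -> equidist P g mu N ->
  equidist (s ++ P) (fun m => elsym (hit_vec R k m) s b * g m)
    (elsym (density R k) s b * mu) (((1 + sumn s) ^ b)%:R * N).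
Proof.
move=> + + eg; have N0 : 0 <= N by case: eg => _ f2 _; apply: le_trans f2.
elim: s b => [|p s IH] [|b] us sv.
- rewrite expn0 [X in equidist _ _ _ X]mul1r.
  by apply: (equidist_ext _ _ eg) => [m|]; rewrite /= mul1r.
- rewrite exp1n [X in equidist _ _ _ X]mul1r; split=> [m||q a X _]; rewrite /= ?mul0r ?normr0 //.
  by rewrite big1 ?mulr0 ?subrr ?normr0 // => h _; rewrite mul0r.
- rewrite expn0 [X in equidist _ _ _ X]mul1r.
  have : equidist (p :: s ++ P) g mu N.
    by apply: equidist_widen eg => // q qP; rewrite inE mem_cat qP !orbT.
  by apply: equidist_ext => [m|] /=; rewrite mul1r.
case/andP: us => pn us; case/andP: sv => /andP[pr kp] sv.
have prP : all prime (s ++ P) by apply: sub_all sv => q /andP[].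
have e1 := IH b us sv; have e2 := IH b.+1 us sv.
have e3 := equidist_hits pr kp (coprime_primes pr prP pn) e1.
have e2' : equidist (p :: s ++ P) (fun m => elsym (hit_vec R k m) s b.+1 * g m)
    (elsym (density R k) s b.+1 * mu) (((1 + sumn s) ^ b.+1)%:R * N).
  by apply: equidist_widen (lexx _) _ e2 => q; rewrite inE => ->; rewrite orbT.
have := equidistD e2' e3.
move/equidist_widen => h.
apply: equidist_ext (h _ _ _ _) => [m|||//].
- by rewrite /= /hit_vec; ring.
- by rewrite /= /density; ring.
rewrite mulrA -mulrDl ler_wpM2r // -natrM -natrD ler_nat /=.
rewrite expnS -mulnDl expnS; apply: leq_mul; first by lia.
by case: b {IH e1 e2 e3 e2' h} => // b; rewrite leq_exp2r; lia.
Qed.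

(** With [w = 2 + sumn (s i)], one level of [lower_part] costs at most
    [w ^ b i + w ^ (b i).+1 <= w ^ (b i + 2)]. *)
Definition sieve_error (s : nat -> seq nat) (b : nat -> nat) (I : seq nat) : nat :=
  (\prod_(i <- I) (2 + sumn (s i)) ^ (b i + 2))%N.

Lemma equidist_parts (R : realFieldType) (k : nat) (s : nat -> seq nat) b I :
  uniq (flatten (map s I)) -> all (sieving k) (flatten (map s I)) ->
  equidist (flatten (map s I)) (fun m => upper_part (hit_vec R k m) s b I)
    (upper_part (density R k) s b I) (sieve_error s b I)%:R /\
  equidist (flatten (map s I)) (fun m => lower_part (hit_vec R k m) s b I)
    (lower_part (density R k) s b I) (sieve_error s b I)%:R.
Proof.
rewrite /sieve_error; elim: I => [|i I IH] /= us sv.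
  by rewrite big_nil; split; apply: equidist1.
have us' : uniq (flatten (map s I)) by move: us; rewrite cat_uniq => /and3P[].
have sv' : all (sieving k) (flatten (map s I)).
  by move: sv; rewrite all_cat => /andP[].
have [eG eF] := IH us' sv'; rewrite big_cons.
set N := (\prod_(j <- I) _)%N in eG eF *.
have hw n : ((1 + sumn (s i)) ^ n <= (2 + sumn (s i)) ^ n)%N.
  by case: n => // n; rewrite leq_exp2r; lia.
have e0 := hw (b i); have e1 := hw (b i).+1.
have e2 : ((2 + sumn (s i)) ^ b i + (2 + sumn (s i)) ^ (b i).+1 <=
           (2 + sumn (s i)) ^ (b i + 2))%N.
  rewrite addn2 !expnS -{1}[(_ ^ b i)%N]mul1n mulnA -mulnDl leq_mul2r.
  by apply/orP; right; nia.
split.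
  apply: equidist_widen (equidist_altsym (b i) us sv eG) => //.
  rewrite -natrM ler_nat leq_mul2r; apply/orP; right; lia.
apply: equidist_widen (equidistD (equidist_altsym (b i) us sv eF)
  (equidistN (equidist_elsym (b i).+1 us sv eG))) => //.
rewrite -mulrDl -natrD -natrM ler_nat leq_mul2r; apply/orP; right; lia.
Qed.

(** The mean of [lower_part] is at least half the density product, so for this [X] the main term
    exceeds the error and some [h] gives a positive value. There the product of the [1 - hits] is
    positive as well, so no factor vanishes. *)
Lemma sieve_exists (R : realFieldType) (k : nat) (s : nat -> seq nat)
    (b : nat -> nat) (tau : nat -> R) (I : seq nat) (q a X : nat) :
  uniq (flatten (map s I)) -> all (sieving k) (flatten (map s I)) ->
  all (coprime q) (flatten (map s I)) ->
  all (fun i => ~~ odd (b i) && (elsym (density R k) (s i) (b i).+1 <=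
        tau i * \prod_(p <- s i) (1 - density R k p))) I ->
  (forall i, 0 <= tau i) -> \sum_(i <- I) tau i <= 2^-1 ->
  (sieve_error s b I)%:R < X%:R * (2^-1 *
     \prod_(i <- I) \prod_(p <- s i) (1 - density R k p)) ->
  exists2 h, (h < X)%N &
    forall i p, i \in I -> p \in s i -> hits k p (a + q * h) = 0%N.
Proof.
move=> us sv cq hI tau0 stau big.
have svI i : i \in I -> all (sieving k) (s i).
  move=> iI; apply/allP => p ps; apply: (allP sv); apply/flatten_mapP; by exists i.
have uI : all (fun i => unit_on (density R k) (s i) && ~~ odd (b i)) I.
  apply/allP => i iI; rewrite density_unit ?svI //=.
  by case/andP: (allP hI i iI).
have hmI m : all (fun i => unit_on (hit_vec R k m) (s i) && ~~ odd (b i)) I.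
  apply/allP => i iI; rewrite hit_vec_unit ?svI //=.
  by case/andP: (allP hI i iI).
have /andP[V0 VG] := upper_part_ge uI.
have Flow : (1 - \sum_(i <- I) tau i) * upper_part (density R k) s b I <=
    lower_part (density R k) s b I.
  apply: lower_part_ge tau0; apply/allP => i iI.
  by rewrite density_unit ?svI // (allP hI i iI).
have [_ [_ _ /(_ q a X cq)]] := equidist_parts R b us sv.
rewrite ler_norml => /andP[h1 _].
have pos : 0 < \sum_(h < X) lower_part (hit_vec R k (a + q * h)) s b I.
  set V := \prod_(i <- I) _ in big V0 VG.
  set G := upper_part _ _ _ _ in VG Flow; set F := lower_part _ _ _ _ in h1 Flow.
  have hF : 2^-1 * V <= F by set t := \sum_(i <- I) _ in stau Flow; nra.
  have := ler_wpM2l (ler0n R X) hF; lra.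
have [h hX hpos] : exists2 h, (h < X)%N &
    0 < lower_part (hit_vec R k (a + q * h)) s b I.
  case: (pickP (fun h : 'I_X => 0 < lower_part (hit_vec R k (a + q * h)) s b I)).
    by move=> h hp; exists (val h); first exact: ltn_ord.
  move=> no; move: pos; rewrite ltNge => /negP[].
  by apply: sumr_le0 => h _; rewrite leNgt no.
exists h => // i p iI ps.
have := lt_le_trans hpos (lower_part_le (hmI _)).
case: (posnP (hits k p (a + q * h))) => // hit.
have e : hits k p (a + q * h) = 1%N.
  apply/eqP; rewrite eqn_leq hit andbT hits_le1 //.
  have /andP[_] := allP (svI i iI) p ps; apply: leq_trans.
  by rewrite leq_pmull.
have z : \prod_(i <- I) \prod_(p <- s i) (1 - hit_vec R k (a + q * h) p) = 0.
  rewrite (big_rem i) //= (big_rem p ps) /= /hit_vec e subrr !mul0r //.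
by rewrite z ltxx.
Qed.

(** * Primes in dyadic ranges *)

Definition primes_in (m n : nat) : seq nat := [seq p <- index_iota m.+1 n.+1 | prime p].

Lemma mem_primes_in m n p : (p \in primes_in m n) = [&& prime p, m < p & p <= n]%N.
Proof. by rewrite mem_filter mem_index_iota ltnS. Qed.

Lemma primes_in_uniq m n : uniq (primes_in m n).
Proof. by rewrite filter_uniq // iota_uniq. Qed.

Lemma primes_in_cat m n o : (m <= n)%N -> (n <= o)%N ->
  primes_in m o = primes_in m n ++ primes_in n o.
Proof.
move=> mn no; rewrite /primes_in -filter_cat /index_iota; congr filter.
have -> : (o.+1 - m.+1 = (n.+1 - m.+1) + (o.+1 - n.+1))%N by lia.
by rewrite iotaD subnKC.
Qed.

Lemma sieving_primes_in k m n : (3 * k <= m)%N -> all (sieving k) (primes_in m n).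
Proof.
move=> km; apply/allP => p; rewrite mem_primes_in => /and3P[pr mp _].
by rewrite /sieving pr (leq_trans km) // ltnW.
Qed.

Lemma prime_dvd_fact p n : prime p -> (p %| n`!)%N = (p <= n)%N.
Proof.
move=> pr; elim: n => [|n IH]; first by rewrite fact0 dvdn1 leqn0; case: p pr => [|[]].
rewrite factS Euclid_dvdM // IH.
case: (leqP p n) => np; first by rewrite orbT leqW.
rewrite orbF; apply/idP/idP => [/dvdn_leq->//|pn].
by rewrite (_ : p = n.+1) //; lia.
Qed.

Lemma bin_le_exp2 n m : ('C(n, m) <= 2 ^ n)%N.
Proof.
elim: n m => [|n IH] [|m]; rewrite ?bin0 ?expn_gt0 //.
by rewrite binS expnS mul2n -addnn leq_add.
Qed.

Lemma prod_primes_dvd (s : seq nat) n :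
  uniq s -> all (fun p => prime p && (p %| n)%N) s -> (\prod_(p <- s) p %| n)%N.
Proof.
elim: s => [|p s IH] /=; first by rewrite big_nil dvd1n.
case/andP=> ps us /andP[/andP[pr pd] h].
rewrite big_cons Gauss_dvd ?pd ?IH //.
have prs : all prime s by apply: sub_all h => q /andP[].
have := coprime_primes pr prs ps.
elim: s {IH h ps us prs} => [|q s IH] /=; first by rewrite big_nil coprimen1.
by case/andP=> cq /IH cs; rewrite big_cons coprimeMr cq.
Qed.

Lemma expn_size_le_prod (s : seq nat) c :
  all (leq c) s -> (c ^ size s <= \prod_(p <- s) p)%N.
Proof.
elim: s => [|p s IH] /=; first by rewrite expn0 big_nil.
by case/andP=> h1 /IH h2; rewrite big_cons expnS leq_mul.
Qed.

(** A prime in [(n, 2n]] divides [(2n)!] but neither factor [n!] of the denominator. *)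
Lemma prod_primes_in_dvd n : (\prod_(p <- primes_in n (2 * n)) p %| 'C(2 * n, n))%N.
Proof.
apply: prod_primes_dvd (primes_in_uniq _ _) _; apply/allP => p.
rewrite mem_primes_in => /and3P[pr np pn]; rewrite pr /=.
have : (p %| (2 * n)`!)%N by rewrite prime_dvd_fact.
have le : (n <= 2 * n)%N by lia.
rewrite -(bin_fact le) (_ : 2 * n - n = n)%N; last by lia.
by rewrite !Euclid_dvdM // !prime_dvd_fact // leqNgt np orbF.
Qed.

(** Chebyshev's argument: these primes exceed [2 ^ l], and their product divides a binomial
    coefficient of size at most [2 ^ (2 * 2 ^ l)]. *)
Lemma size_primes_dyadic l :
  (l * size (primes_in (2 ^ l) (2 ^ l.+1)) <= 2 * 2 ^ l)%N.
Proof.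
set s := primes_in _ _.
have : ((2 ^ l) ^ size s <= 2 ^ (2 * 2 ^ l))%N.
  apply: leq_trans (bin_le_exp2 _ (2 ^ l)).
  apply: leq_trans (dvdn_leq _ (prod_primes_in_dvd _)); last first.
    by rewrite bin_gt0; lia.
  rewrite -expnS -/s; apply: expn_size_le_prod.
  by apply/allP => p; rewrite mem_primes_in => /and3P[_ /ltnW].
by rewrite -expnM leq_exp2l.
Qed.

Lemma sum_density_dyadic (R : realFieldType) k l a : (2 * k <= a)%N -> (0 < l)%N ->
  \sum_(p <- primes_in (2 ^ l) (2 ^ l.+1)) density R k p <= a%:R / l%:R.
Proof.
move=> ka l0; set s := primes_in _ _.
have l0R : 0 < l%:R :> R by rewrite ltr0n.
have t0 : 0 < (2 ^ l)%:R :> R by rewrite ltr0n expn_gt0.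
apply: (@le_trans _ _ (\sum_(p <- s) k%:R / (2 ^ l)%:R)).
  rewrite big_seq [leRHS]big_seq; apply: ler_sum => p.
  rewrite mem_primes_in => /and3P[_ /ltnW h _].
  rewrite /density ler_wpM2l ?ler0n // lef_pV2 ?posrE ?ler_nat //.
  by rewrite ltr0n; apply: leq_trans h; rewrite expn_gt0.
rewrite big_const_seq count_predT iter_addr_0.
rewrite -[_ *+ size s]mulr_natr mulrAC.
rewrite ler_pdivrMr // mulrAC ler_pdivlMr // -!natrM ler_nat.
have := size_primes_dyadic l; rewrite -/s => h.
have := leq_mul (leqnn k) h; have := leq_mul ka (leqnn (2 ^ l)); lia.
Qed.

Lemma density_dyadic_range (R : realFieldType) k L n a :
  (0 < a)%N -> (2 * k <= a)%N -> (a <= L)%N -> (3 * k <= 2 ^ L)%N ->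
  \sum_(p <- primes_in (2 ^ L) (2 ^ (L + n))) density R k p <= n%:R * (a%:R / L%:R)
  /\ (1 - a%:R / L%:R) ^+ n <=
     \prod_(p <- primes_in (2 ^ L) (2 ^ (L + n))) (1 - density R k p).
Proof.
move=> a0 ka aL kL; have L0 : (0 < L)%N by lia.
have L0R : 0 < L%:R :> R by rewrite ltr0n.
have c0 : 0 <= 1 - a%:R / L%:R :> R.
  by rewrite subr_ge0 ler_pdivrMr // mul1r ler_nat.
elim: n => [|n [IH1 IH2]].
  have -> : primes_in (2 ^ L) (2 ^ (L + 0)) = [::].
    by rewrite addn0 /primes_in /index_iota subnn.
  by rewrite !big_nil mul0r expr0.
have e : primes_in (2 ^ L) (2 ^ (L + n.+1)) = primes_in (2 ^ L) (2 ^ (L + n)) ++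
    primes_in (2 ^ (L + n)) (2 ^ (L + n).+1).
  by rewrite -primes_in_cat ?leq_exp2l ?addnS // leq_addr.
have d : \sum_(p <- primes_in (2 ^ (L + n)) (2 ^ (L + n).+1)) density R k p <=
    a%:R / L%:R.
  apply: le_trans (sum_density_dyadic R ka _) _; first by rewrite addn_gt0 L0.
  rewrite ler_wpM2l ?ler0n // lef_pV2 ?posrE ?ltr0n ?ler_nat ?leq_addr //.
  by rewrite addn_gt0 L0.
rewrite e !big_cat /= -natr1 mulrDl mul1r lerD //; split=> //.
rewrite exprSr ler_pM ?exprn_ge0 //.
have sv : all (sieving k) (primes_in (2 ^ (L + n)) (2 ^ (L + n).+1)).
  apply: sieving_primes_in; apply: leq_trans kL _; by rewrite leq_exp2l // leq_addr.
have := prod_compl_ge (density_unit R sv); apply: le_trans; lra.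
Qed.

(** * Doubly exponential levels *)

Definition level (i : nat) : seq nat := primes_in (2 ^ (2 ^ i)) (2 ^ (2 ^ i.+1)).

Lemma bernoulli (R : realFieldType) (x : R) n : 0 <= x <= 1 -> 1 - n%:R * x <= (1 - x) ^+ n.
Proof.
case/andP=> x0 x1; elim: n => [|n IH]; first by rewrite mul0r subr0 expr0.
have h : 0 <= 1 - x by rewrite subr_ge0.
rewrite exprS -natr1; apply: le_trans (ler_wpM2l h IH).
have : 0 <= n%:R * (x * x) by rewrite !mulr_ge0 ?ler0n.
by lra.
Qed.

(** Level [i] consists of [2 ^ i] dyadic blocks, each of density sum at most [2 ^ e / 2 ^ i], so the
    dependence on [i] cancels. *)
Lemma density_level (R : realFieldType) k i e :
  (2 * k <= 2 ^ e)%N -> (e < i)%N ->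
  \sum_(p <- level i) density R k p <= (2 ^ e)%:R /\
  2^-1 ^+ (2 * 2 ^ e) <= \prod_(p <- level i) (1 - density R k p).
Proof.
move=> ke ei; set a := (2 ^ e)%N.
have a0 : (0 < a)%N by rewrite expn_gt0.
have aL : (a <= 2 ^ i)%N by rewrite leq_exp2l // ltnW.
have kL : (3 * k <= 2 ^ (2 ^ i))%N.
  apply: (@leq_trans (2 ^ i.+1)); last by rewrite leq_exp2l // ltn_expl.
  have := leq_pexp2l (isT : 0 < 2)%N ei; rewrite !expnS -/a in ke *; lia.
have [] := density_dyadic_range R (2 ^ i) a0 ke aL kL.
rewrite addnn -mul2n -expnS -/(level i).
have L0R : 0 < (2 ^ i)%:R :> R by rewrite ltr0n expn_gt0.
rewrite mulrCA mulfV ?mulr1 ?gt_eqF // => h1 h2; split=> //.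
(* The [2 ^ i] factors form [2 * a] groups of [n]; as [n * a / 2 ^ i] is one half, Bernoulli bounds
   each group below by one half. *)
apply: le_trans h2; set n := (2 ^ (i - e.+1))%N.
have en : (2 ^ i = n * (2 * a))%N by rewrite -expnS -expnD subnK.
set x := 1 - _.
have x0 : 0 <= x by rewrite subr_ge0 ler_pdivrMr // mul1r ler_nat.
rewrite [leRHS](_ : _ = (x ^+ n) ^+ (2 * a)); last by rewrite -exprM -en.
have a2 : (0 < 2 * a)%N by rewrite muln_gt0.
rewrite ler_pXn2r ?nnegrE ?invr_ge0 ?ler0n ?exprn_ge0 //.
have := @bernoulli R (a%:R / (2 ^ i)%:R) n; rewrite divr_ge0 ?ler0n //=.
rewrite ler_pdivrMr // mul1r ler_nat aL => /(_ isT); apply: le_trans.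
have n0 : n%:R != 0 :> R by rewrite pnatr_eq0 -lt0n expn_gt0.
have a0' : a%:R != 0 :> R by rewrite pnatr_eq0 -lt0n.
rewrite en !natrM; suff -> : n%:R * (a%:R / (n%:R * (2 * a%:R))) = 2^-1 :> R by lra.
by field; rewrite n0 a0'.
Qed.

(** Count times maximum gives [(A - B) * A] with [A = 2 ^ 2 ^ i.+1] and [B = 2 ^ 2 ^ i]; the missing
    [B * A] absorbs the 2. *)
Lemma sumn_level i : (2 + sumn (level i) <= 2 ^ (2 ^ (i + 2)))%N.
Proof.
have sl s n : all (fun p => p <= n)%N s -> (sumn s <= size s * n)%N.
  by elim: s => //= p s IH /andP[h1 /IH h2]; rewrite mulSn leq_add.
have h : (sumn (level i) <= size (level i) * 2 ^ (2 ^ i.+1))%N.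
  by apply: sl; apply/allP => p; rewrite mem_primes_in => /and3P[].
have hs : (size (level i) <= 2 ^ 2 ^ i.+1 - 2 ^ 2 ^ i)%N.
  rewrite size_filter; apply: leq_trans (count_size _ _) _.
  by rewrite size_iota subSS.
have -> : (2 ^ 2 ^ (i + 2) = 2 ^ 2 ^ i.+1 * 2 ^ 2 ^ i.+1)%N.
  by rewrite -expnD addnn -mul2n -expnS addn2.
have h1 : (2 ^ 1 <= 2 ^ 2 ^ i)%N by rewrite leq_exp2l // expn_gt0.
have h2 : (2 ^ 2 ^ i <= 2 ^ 2 ^ i.+1)%N by rewrite !leq_exp2l.
move: h hs h1 h2; rewrite expn1.
set A := (2 ^ 2 ^ i.+1)%N; set B := (2 ^ 2 ^ i)%N => h hs h1 h2.
have := leq_mul hs (leqnn A); have := leq_mul h1 (leqnn A).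
rewrite mulnBl; have := leq_mul h2 (leqnn A); lia.
Qed.

Lemma flatten_levels i0 n :
  flatten (map level (index_iota i0 (i0 + n))) =
  primes_in (2 ^ 2 ^ i0) (2 ^ 2 ^ (i0 + n)).
Proof.
rewrite /index_iota addKn; elim: n => [|n IH].
  by rewrite addn0 /primes_in /index_iota subnn.
rewrite -addn1 iotaD map_cat flatten_cat IH /= cats0 /level -primes_in_cat.
- by rewrite addn1 addnS.
- by rewrite !leq_exp2l // leq_addr.
- by rewrite !leq_exp2l.
Qed.

(** * The sieve *)

Lemma expn_le_fact c j : (0 < c)%N -> (c ^ j <= j`! * c ^ c)%N.
Proof.
move=> c0; elim: j => [|j IH]; first by rewrite fact0 mul1n expn0 expn_gt0 c0.
case: (leqP j.+1 c) => jc.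
  by apply: leq_trans (leq_pexp2l c0 jc) _; rewrite leq_pmull // fact_gt0.
by rewrite expnS factS -mulnA leq_mul // ltnW.
Qed.

(** [expn_le_fact] at [2 * a] leaves [2 ^ j] to spare, and its loss [(2 * a) ^ (2 * a)] is at most
    [2 ^ (4 * a ^ 2)]. *)
Lemma expn_shift_le_fact a t j : (0 < a)%N -> (t + 4 * a ^ 2 <= j)%N ->
  (2 ^ t * a ^ j <= j`!)%N.
Proof.
move=> a0 tj; have := @expn_le_fact (2 * a) j; rewrite muln_gt0 a0 => /(_ isT) h.
have h1 : ((2 * a) ^ (2 * a) <= 2 ^ (4 * a ^ 2))%N.
  apply: (@leq_trans ((2 ^ (2 * a)) ^ (2 * a))).
    by rewrite leq_exp2r ?muln_gt0 // ltnW // ltn_expl.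
  by rewrite -expnM leq_exp2l //; lia.
have h2 := leq_trans h (leq_mul (leqnn _) h1).
rewrite -(leq_pmul2r (_ : 0 < 2 ^ (4 * a ^ 2)))%N ?expn_gt0 //.
apply: leq_trans h2; rewrite mulnAC -expnD expnMn leq_mul2r.
by rewrite leq_exp2l // tj orbT.
Qed.

Lemma sum_half_powers (R : realFieldType) i0 r : (i0 <= r)%N ->
  \sum_(i <- index_iota i0 r) 2^-1 ^+ (r - i + 1) <= 2^-1 :> R.
Proof.
move=> ir; have h0 n : 0 <= 2^-1 ^+ n :> R by rewrite exprn_ge0 // invr_ge0 ler0n.
have e : \sum_(i < r) 2^-1 ^+ (r - i + 1) + 2^-1 ^+ r.+1 = 2^-1 :> R.
  elim: r {ir} => [|r IH]; first by rewrite big_ord0 add0r expr1.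
  rewrite big_ord_recl /= subn0 -[RHS]IH addn1.
  under eq_bigr => i _ do rewrite /bump /= add1n subSS.
  rewrite (exprS _ r.+1); lra.
have : \sum_(i < r) 2^-1 ^+ (r - i + 1) <= 2^-1 :> R by have := h0 r.+1; lra.
apply: le_trans; rewrite -(big_mkord xpredT (fun i => 2^-1 ^+ (r - i + 1))).
by rewrite (big_cat_nat (leq0n i0) ir) /= lerDr sumr_ge0.
Qed.

Lemma sum_level_exponents c i0 r : (i0 <= r)%N ->
  (\sum_(i <- index_iota i0 r) 2 ^ i * (c + 2 * (r - i.+1)) <= 2 ^ r * (c + 2))%N.
Proof.
move=> ir.
(* Extended down to [i = 0], the sum has a closed form; the weights [2 ^ i] outgrow the linear
   factor. *)
have e : (\sum_(i < r) 2 ^ i * (c + 2 * (r - i.+1)) + c + 2 * r + 2 = 2 ^ r * (c + 2))%N.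
  elim: r {ir} => [|r IH]; first by rewrite big_ord0; lia.
  rewrite big_ord_recl /= expnS -mulnA -IH.
  under eq_bigr => i _ do rewrite /bump /= add1n subSS expnS -mulnA.
  rewrite -big_distrr /= subn1 /=; lia.
apply: (@leq_trans (\sum_(i < r) 2 ^ i * (c + 2 * (r - i.+1)))); last by rewrite -e; lia.
rewrite -(big_mkord xpredT (fun i => 2 ^ i * (c + 2 * (r - i.+1))))%N.
by rewrite (big_cat_nat (leq0n i0) ir) /= leq_addl.
Qed.

(** The sieving limit is [2 ^ 2 ^ r], so the total error is a power of it whose exponent does not
    depend on [r]. *)
Lemma sieve_error_levels B i0 r : (i0 <= r)%N ->
  (sieve_error level (fun i => B + 2 * (r - i.+1)) (index_iota i0 r) <=
   2 ^ (4 * (B + 4) * 2 ^ r))%N.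
Proof.
move=> ir; rewrite /sieve_error.
apply: (@leq_trans (\prod_(i <- index_iota i0 r)
    2 ^ (4 * (2 ^ i * (B + 2 + 2 * (r - i.+1)))))%N).
  apply: leq_prod => i _.
  apply: (@leq_trans ((2 ^ 2 ^ (i + 2)) ^ (B + 2 * (r - i.+1) + 2))%N).
    by rewrite leq_exp2r ?sumn_level // addn2.
  by rewrite -expnM leq_exp2l // expnD; lia.
rewrite -expn_sum leq_exp2l // -big_distrr /=.
have := sum_level_exponents (B + 2) ir; lia.
Qed.

(** [h] stays below the [C]-th power of the sieving limit with [C] independent of [r]; this
    uniformity later bounds the number of prime divisors. *)
Theorem brun_sieve (k : nat) : exists i0 C : nat,
  (k <= 2 ^ 2 ^ i0)%N /\
  forall r q a : nat, (i0 <= r)%N ->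
    (forall p, prime p -> (2 ^ 2 ^ i0 < p)%N -> coprime q p) ->
    exists2 h, (h < 2 ^ (C * 2 ^ r))%N &
      forall p j, prime p -> (2 ^ 2 ^ i0 < p <= 2 ^ 2 ^ r)%N -> (j < k)%N ->
        ~~ (p %| a + q * h + j)%N.
Proof.
(* [A] bounds the density sum of every level, and [i0 > e] makes [density_level] apply to all of
   them. [B] is even and large enough for [expn_shift_le_fact]. *)
pose e := (2 * k)%N; pose i0 := e.+1; pose A := (2 ^ e)%N.
pose B := (2 * (A + 2 * A ^ 2 + 1))%N.
have ke : (2 * k <= 2 ^ e)%N by rewrite ltnW // ltn_expl.
have A0 : (0 < A)%N by rewrite expn_gt0.
have k3 : (3 * k <= 2 ^ 2 ^ i0)%N.
  apply: (@leq_trans (2 ^ i0)); first by rewrite expnS; lia.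
  by rewrite leq_exp2l // ltnW // ltn_expl.
exists i0, (4 * (B + 4) + 2 * A + 2)%N; split; first by apply: leq_trans k3; lia.
move=> r q a ir cq; set X := (2 ^ _)%N.
(* The growth of [b] by 2 per level downwards pays for the halving of [tau], whose sum stays below
   one half. *)
pose b i := (B + 2 * (r - i.+1))%N; pose I := index_iota i0 r.
pose tau i : rat := 2^-1 ^+ (r - i + 1).
have fl : flatten (map level I) = primes_in (2 ^ 2 ^ i0) (2 ^ 2 ^ r).
  by rewrite /I -(subnKC ir) flatten_levels.
have half0 n : 0 <= 2^-1 ^+ n :> rat by rewrite exprn_ge0 // invr_ge0 ler0n.
have inI i : i \in I -> (e < i < r)%N by rewrite mem_index_iota.
have sv : all (sieving k) (flatten (map level I)) by rewrite fl sieving_primes_in.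
have svi i : i \in I -> all (sieving k) (level i).
  by move=> iI; apply/allP => p ps; apply: (allP sv); apply/flatten_mapP; exists i.
have [h hX hh] : exists2 h, (h < X)%N &
    forall i p, i \in I -> p \in level i -> hits k p (a + q * h) = 0%N.
  apply: (@sieve_exists rat k level b tau I q a X) => //.
  - by rewrite fl primes_in_uniq.
  - rewrite fl; apply/allP => p; rewrite mem_primes_in => /and3P[pr lt _].
    exact: cq.
  - apply/allP => i iI; rewrite /b /B -mulnDr oddM /=.
    have /andP[ei lir] := inI i iI.
    have [s1 s2] := density_level rat ke ei.
    (* The density product of a level is at least [2^-1 ^+ (2 * A)], so it suffices that
       [A ^ j / j!] is at most [tau i] times this. *)
    apply: (@le_trans _ _ (tau i * 2^-1 ^+ (2 * A))); last first.
      by apply: ler_wpM2l => //; apply: half0.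
    set j := (_.+1); have := elsym_fact_le j (density_unit rat (svi i iI)).
    set E := elsym _ _ _; set S := \sum_(p <- level i) _ in s1 * => hE.
    have S0 : 0 <= S.
      rewrite /S big_seq; apply: sumr_ge0 => p pl.
      by case/andP: (allP (density_unit rat (svi i iI)) p pl).
    have hE' : j`!%:R * E <= (A ^ j)%:R.
      by apply: le_trans hE _; rewrite natrX lerXn2r ?nnegrE ?ler0n.
    rewrite /tau -exprD; set n := (_ + 2 * A)%N.
    have hn : (2 ^ n * A ^ j <= j`!)%N.
      by apply: expn_shift_le_fact => //; rewrite /n /j; lia.
    have p2 : 0 < (2 : rat) ^+ n by rewrite exprn_gt0 // ltr0n.
    have f0 : 0 < j`!%:R :> rat by rewrite ltr0n fact_gt0.
    rewrite exprVn -[E](mulKf (lt0r_neq0 f0)) ler_pdivrMl //.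
    apply: le_trans hE' _; rewrite ler_pdivlMr // -natrX -natrM ler_nat.
    by rewrite mulnC.
  - by move=> i; apply: half0.
  - exact: sum_half_powers.
  apply: le_lt_trans (_ : (2 ^ (4 * (B + 4) * 2 ^ r))%:R < _).
    by rewrite ler_nat; apply: sieve_error_levels.
  (* There are at most [r <= 2 ^ r] levels, each contributing at least [2^-1 ^+ (2 * A)]. *)
  have V : 2^-1 ^+ (2 * A * 2 ^ r) <=
     \prod_(i <- I) \prod_(p <- level i) (1 - density rat k p).
    apply: (@le_trans _ _ (\prod_(i <- I) 2^-1 ^+ (2 * A))).
      rewrite prodrXr; apply: ler_wiXn2l; rewrite ?invr_ge0 ?invf_le1 ?ler0n ?ler1n //.
      rewrite sum_nat_const_nat mulnC leq_mul2l; apply/orP; right.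
      by apply: leq_trans (leq_subr _ _) (ltnW (ltn_expl _ _)).
    rewrite big_seq [leRHS]big_seq; apply: ler_prod => i /inI/andP[ei _].
    by have [_ ->] := density_level rat ke ei; rewrite half0.
  have two n : (2 : rat) ^+ n * 2^-1 ^+ n = 1 by rewrite -exprMn mulfV ?expr1n.
  apply: (@lt_le_trans _ _ (X%:R * 2^-1 ^+ (1 + 2 * A * 2 ^ r))); last first.
    by rewrite exprD expr1 ler_wpM2l ?ler0n // ler_wpM2l // invr_ge0 ler0n.
  (* The second factor cancels the loss in the main term; the first exceeds the error bound because
     [2 * 2 ^ r - 1 > 0]. *)
  have -> : X = (2 ^ (4 * (B + 4) * 2 ^ r + (2 * 2 ^ r - 1)) *
                 2 ^ (1 + 2 * A * 2 ^ r))%N.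
    rewrite /X -expnD; congr (_ ^ _)%N; have : (0 < 2 ^ r)%N by rewrite expn_gt0.
    by lia.
  rewrite natrM [(2 ^ (1 + _))%:R]natrX -mulrA two mulr1 ltr_nat ltn_exp2l //.
  have : (0 < 2 ^ r)%N by rewrite expn_gt0.
  by lia.
exists h => // p j pr /andP[p1 p2] jk.
have : p \in flatten (map level I) by rewrite fl mem_primes_in pr p1.
case/flatten_mapP => i iI pl; exact: hits_eq0 (hh i p iI pl) jk.
Qed.

Local Close Scope ring_scope.

(** * Almost primes and trees *)

(** [t n] depends on [n] only through this sequence, so trees need not be compared recursively. *)
Definition exponents (n : nat) : seq nat := [seq pa.2 | pa <- prime_decomp n].

Lemma t_exponents (n : nat) : t n = Node (map t (exponents n)).
Proof. by rewrite tE /exponents -map_comp. Qed.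

Definition exponents_bounded (c n : nat) : bool :=
  (size (exponents n) <= c) && all (fun a => a <= c) (exponents n).

Lemma exponents_boundedP (c n : nat) :
  size (primes n) <= c -> (forall p, p \in primes n -> logn p n <= c) ->
  exponents_bounded c n.
Proof.
move=> sz lg; rewrite /exponents_bounded /exponents prime_decompE -map_comp.
rewrite size_map sz; apply/allP => a /mapP[p pp ->]; exact: lg.
Qed.

Lemma logn_add_le (p n d : nat) : prime p -> 0 < n ->
  p ^ (logn p n).+1 %| d -> logn p (n + d) <= logn p n.
Proof.
move=> pr n0 pd; rewrite leqNgt -pfactor_dvdn ?addn_gt0 ?n0 //.
by rewrite dvdn_addl // pfactor_dvdn // ltnn.
Qed.

(** At most [D] primes are small; the product of the others divides [n < z ^ c], and each is at
    least [z]. *)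
Lemma size_primes_le (D z c n : nat) : 0 < n -> 1 < z -> n < z ^ c ->
  (forall p, p \in primes n -> D < p -> z <= p) -> size (primes n) <= D + c.
Proof.
move=> n0 z1 nz big; pose small := [pred p | p <= D].
rewrite -(count_predC small); apply: leq_add.
  rewrite -size_filter -[X in _ <= X](size_iota 1 D); apply: uniq_leq_size.
    by rewrite filter_uniq // primes_uniq.
  move=> p; rewrite mem_filter mem_iota mem_primes => /andP[/= pD /and3P[pr _ _]].
  by rewrite prime_gt0 // add1n ltnS.
rewrite -size_filter; set s := filter _ _.
rewrite -(leq_exp2l _ _ z1) ltnW //; apply: leq_ltn_trans nz.
apply: (@leq_trans (\prod_(p <- s) p)).
  apply: expn_size_le_prod; apply/allP => p; rewrite mem_filter /= -ltnNge.
  by case/andP=> Dp pp; apply: big.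
apply: dvdn_leq => //; apply: prod_primes_dvd; first by rewrite filter_uniq ?primes_uniq.
apply/allP => p; rewrite mem_filter mem_primes => /andP[_ /and3P[-> _ ->]] //.
Qed.

Lemma exponents_bounded_unbounded (k : nat) : exists c, forall N, exists2 m,
  N < m & forall j, j <= k -> exponents_bounded c (m + j).
Proof.
have [i0 [C [kD sieve]]] := brun_sieve k.+1.
set D := 2 ^ 2 ^ i0 in kD sieve.
(* One copy of the factorial is divisible by [j.+1], the other supplies the additional factor [p]
   that [logn_add_le] requires. *)
pose W := D`! * D`!.
have W0 : 0 < W by rewrite muln_gt0 fact_gt0.
have pW p : prime p -> p <= D -> p %| W.
  by move=> pr pD; rewrite dvdn_mulr // prime_dvd_fact.
(* [r] contains [N], which forces [m > N], and [2 + 2 * W + k], so that a factor [z > r] absorbs the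
   constants in [m + j < z ^ (C + 2)]. *)
exists (D + (C + 2)) => N; pose r := i0 + N + (2 + 2 * W + k).
have ir : i0 <= r by rewrite /r -addnA leq_addr.
have cW p : prime p -> D < p -> coprime W p.
  move=> pr Dp; rewrite coprime_sym prime_coprime // /W Euclid_dvdM // orbb.
  by rewrite prime_dvd_fact // -ltnNge.
have [h hX hh] := sieve r W (1 + W) ir cW; clear sieve.
set z := 2 ^ 2 ^ r in hh.
have rz : r < z.
  by apply: leq_ltn_trans (ltnW (ltn_expl r (isT : 1 < 2))) (ltn_expl _ (isT : 1 < 2)).
have z1 : 1 < z by apply: leq_ltn_trans rz; rewrite /r; lia.
(* The extra [W] keeps [m > 1] even at [h = 0], so [m] has a prime divisor. *)
pose m := 1 + W + W * h.
have em j : m + j = j.+1 + W * h.+1 by rewrite /m mulnS; lia.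
have bigp p j : j <= k -> prime p -> p %| m + j -> D < p -> z < p.
  move=> jk pr pd Dp; rewrite ltnNge; apply/negP => pz.
  by have := hh p j pr; rewrite Dp pz => /(_ isT jk); rewrite pd.
have mz j : j <= k -> m + j < z ^ (C + 2).
  move=> jk; have -> : z ^ (C + 2) = z * (z * 2 ^ (C * 2 ^ r)).
    by rewrite addn2 !expnS -expnM [2 ^ r * C]mulnC.
  set X := 2 ^ (C * 2 ^ r) in hX *; have Wz : 2 + 2 * W + k <= z.
    by apply: leq_trans (ltnW rz); rewrite /r leq_addl.
  have h1 : W * h <= W * X by rewrite leq_mul2l (ltnW hX) orbT.
  have X0 : 0 < X by apply: leq_ltn_trans hX.
  have h2 : (2 + 2 * W + k) * X <= z * X by rewrite leq_mul2r Wz orbT.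
  have h3 : z * X <= z * (z * X) by rewrite leq_mul2l leq_pmull ?orbT // ltnW.
  apply: leq_trans h3; apply: leq_trans h2; rewrite /m.
  have : (2 + W + k) * 1 <= (2 + W + k) * X by rewrite leq_mul2l X0 orbT.
  rewrite !mulnDl; lia.
exists m => [|j jk].
  (* [m] is 1 mod [W], so its least prime divisor exceeds [D], hence [z], hence [N]. *)
  have m1 : 1 < m by rewrite /m; lia.
  have pr := pdiv_prime m1; have pd := pdiv_dvd m.
  have : z < pdiv m.
    apply: (@bigp _ 0) => //; first by rewrite addn0.
    rewrite ltnNge; apply/negP => /(pW _ pr) pw.
    move: pd; rewrite /m -addnA dvdn_addl; last by rewrite dvdn_add // dvdn_mulr.
    by rewrite dvdn1 => /eqP e; rewrite e in pr.
  have := dvdn_leq (ltnW m1) pd; rewrite /r in rz; lia.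
have n0 : 0 < m + j by rewrite /m; lia.
apply: exponents_boundedP => [|p].
  apply: (@size_primes_le D z) => //; first exact: mz.
  by move=> p; rewrite mem_primes => /and3P[pr _ pd] Dp; apply: ltnW; apply: bigp pd Dp.
rewrite mem_primes => /and3P[pr _ pd].
case: (leqP p D) => pD.
  apply: (@leq_trans D); last exact: leq_addr.
  apply: (@leq_trans (logn p j.+1)).
    rewrite em; apply: logn_add_le => //.
    apply: dvdn_mulr; rewrite /W expnS; apply: dvdn_mul; first by rewrite prime_dvd_fact.
    apply: dvdn_trans (pfactor_dvdnn _ _) _; apply: dvdn_fact.
    by rewrite /= (leq_trans _ kD).
  apply: (@leq_trans j.+1); last by apply: leq_trans kD; rewrite ltnS.
  by rewrite ltnW // ltn_logl.
(* A prime beyond [D] exceeds [z], so its exponent in [m + j < z ^ (C + 2)] is below [C + 2]. *)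
apply: (@leq_trans (C + 2)); last exact: leq_addl.
rewrite -(leq_exp2l _ _ z1) ltnW //; apply: leq_ltn_trans (mz j jk).
have zp := bigp p j jk pr pd pD.
apply: (@leq_trans (p ^ logn p (m + j))).
  by case: (logn _ _) => // l; rewrite leq_exp2r // ltnW.
by apply: dvdn_leq => //; apply: pfactor_dvdnn.
Qed.

(** * Pigeonhole and infinitude *)

Lemma pigeonhole_unbounded (T : finType) (P : T -> nat -> Prop) :
  (forall N, exists2 m, N < m & exists c, P c m) ->
  exists c, forall N, exists2 m, N < m & P c m.
Proof.
move=> h; apply: contrapT => no.
have bnd c : exists N, forall m, N < m -> ~ P c m.
  apply: contrapT => nb; apply: no; exists c => N.
  apply: contrapT => nm; apply: nb; exists N => m Nm Pm; apply: nm; by exists m.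
(* If every colour [c] stopped at [f c], a point beyond the maximum would have no colour. *)
have [f fP] := choice bnd.
have [m mN [c Pc]] := h (\max_(c : T) f c).
by apply: (fP c m) Pc; apply: leq_ltn_trans mN; apply: leq_bigmax.
Qed.

Lemma infinite_set_nat_unbounded (A : set nat) :
  (forall N, exists2 m, N < m & A m) -> infinite_set A.
Proof.
move=> h /finite_seqP[s eA]; have [m mN] := h (\max_(i <- s) i).
rewrite eA /= => ms; move: mN; apply/negP; rewrite -leqNgt.
exact: (bigop.leq_bigmax_seq m ms).
Qed.

Theorem theorem4 (k : nat) (hk : 1 <= k) :
  exists n : nat, 1 <= n /\ infinite_set (O_set n k).
Proof.
have [c hc] := exponents_bounded_unbounded k.
(* The colour of [m] is the tuple of its exponent sequences; capping lengths and entries by [c]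
   makes the colours a finite type. *)
pose P (f : {ffun 'I_k.+1 -> {bseq c of 'I_c.+1}}) (m : nat) :=
  forall j : 'I_k.+1, exponents (m + j) = map val (f j).
have [|f hf] := @pigeonhole_unbounded _ P.
  move=> N; have [m Nm mP] := hc N; exists m => //.
  have sz (j : 'I_k.+1) : size (map (@inord c) (exponents (m + j))) <= c.
    by rewrite size_map; case/andP: (mP j (ltnSE (ltn_ord j))).
  exists [ffun j => Bseq (sz j)] => j; rewrite ffunE /= -map_comp.
  rewrite map_id_in // => a /(allP (proj2 (andP (mP j (ltnSE (ltn_ord j)))))) ac.
  by rewrite /= inordK.
(* Any positive member of the unbounded colour class can serve as [n]. *)
have [n n0 fn] := hf 0; exists n; split=> //.
apply: infinite_set_nat_unbounded => N; have [m Nm fm] := hf N; exists m => //.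
split=> [|j /andP[_ jk]]; first exact: leq_ltn_trans Nm.
have := fm (Ordinal (jk : j < k.+1)); rewrite -fn /= => e.
by rewrite !t_exponents e.
Qed.
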